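(* Let $\mu\in\mathbb R$, $\mathcal E_\mu=\mathcal E-\mu\mathbf 1$, and assume $\mathcal E_\mu>0$. Then the integral $$\int d\mu_{\mathbf V}(h)\int_{\mathbb C^{\mathbb X_T}}\mathcal Da\;e^{-(\bar a,\mathcal K(h)a)_{\mathbb X_T}}$$ is absolutely convergent. The grand-canonical covariance $\mathcal G(h)=\mathcal K(h)^{-1}$ exists for all real $h$, and its norm is bounded uniformly in $h$. It is analytic in $h$ on the set where $|\mathrm{Im}\,h_{j,x}|<\sqrt\epsilon\,e_{\min}$ for all $(j,x)$, where $e_{\min}$ is the smallest eigenvalue of $\mathcal E_\mu$. If $\mathcal E_\mu$ generates a stochastic process, then for all $j'\ge j$, all $x,x'\in\Lambda$ and all real $h$, $$\big|\mathcal G(h)_{(j,x),(j',x')}\big|\le\mathcal G(0)_{(j,x),(j',x')} .$$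
   Context: $\Lambda$ finite discrete torus $\mathbb Z^d/L\mathbb Z^d$ (spacing $1$, $(f,g)_\Lambda=\sum_xf_xg_x$); operators on $\mathbb C^\Lambda$ are matrices; functions on $\Lambda$ act as multiplication operators. $\mathcal E$ hermitian, $v$ real symmetric with $v\ge0$ (standing assumption). $\beta>0$, $n_\tau\in\mathbb N$, $\epsilon=\beta/n_\tau$, $\mathbb X_T=\{0,\dots,n_\tau\}\times\Lambda$, $a=(a_j)_{j=0}^{n_\tau}$, $a_j\in\mathbb C^\Lambda$, $\mathcal Da=\prod_{j,x}\frac{d\bar a_{j,x}\wedge da_{j,x}}{2\pi i}$. $h=(h_j)_{j=1}^{n_\tau}$, $h_j\in\mathbb R^\Lambda$ (complexified for the analyticity statement), $h_0=0$; $\mu_v$ the centered Gaussian probability measure on $\mathbb R^\Lambda$ with covariance $v$, $d\mu_{\mathbf V}(h)=\prod_{j=1}^{n_\tau}d\mu_v(h_j)$. $\mathcal K(h)$ is the block matrix indexed by $j,j'\in\{0,\dots,n_\tau\}$ with $\mathcal K(h)_{j,j'}=\delta_{j,j'}\mathbf 1-\delta_{j+1,j'}e^{-\epsilon\mathcal E_\mu}e^{i\sqrt\epsilon h_{j'}}-\delta_{j,n_\tau}\delta_{0,j'}\mathbf 1$, and $(\bar a,\mathcal K(h)a)_{\mathbb X_T}=\sum_{j,j'}(\bar a_j,\mathcal K(h)_{j,j'}a_{j'})_\Lambda$. An operator $T$ generates a stochastic process if $(e^{-\tau T})_{x,y}\ge0$ for all $\tau\ge0$, $x,y$. *)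

(* Defs.v *)
From HB Require Import structures.
From mathcomp Require Export all_boot all_order all_algebra.
From mathcomp Require Export complex.
From mathcomp Require Export all_classical all_reals all_analysis.
Export Order.TTheory GRing.Theory Num.Theory.
Export numFieldNormedType.Exports.

Set Implicit Arguments.
Unset Strict Implicit.
Unset Printing Implicit Defensive.

Local Open Scope ring_scope.
Local Open Scope complex_scope.

(** The finite discrete torus Λ = Z^d / L Z^d, realised as 'I_d -> 'I_L.
    Vectors/operators on C^Λ are indexed by 'I_#|Lam d L| via enum_rank. *)
Definition Lam (d L : nat) := {ffun 'I_d -> 'I_L}.

Definition hermitian (R : rcfType) n (A : 'M[R[i]]_n) : Prop :=
  A^T = map_mx (@conjc R) A.

Definition posdef (R : rcfType) n (A : 'M[R[i]]_n) : Prop :=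
  forall u : 'rV[R[i]]_n, u != 0 ->
    0 < (map_mx (@conjc R) u *m A *m u^T) 0 0.

Definition symmetric_psd (R : realType) n (v : 'M[R]_n) : Prop :=
  v^T = v /\ forall u : 'rV[R]_n, 0 <= (u *m v *m u^T) 0 0.

Definition expm (R : realType) n (A : 'M[R[i]]_n) : 'M[R[i]]_n :=
  limn (fun N => \sum_(k < N) (k`!%:R)^-1 *: A ^+ k).

Definition cexp (R : realType) (z : R[i]) : R[i] :=
  (expR (complex.Re z))%:C * ((cos (complex.Im z))%:C + 'i * (sin (complex.Im z))%:C).

Definition generates_stochastic (R : realType) n (T : 'M[R[i]]_n) : Prop :=
  forall tau : R, 0 <= tau -> forall x y : 'I_n,
    0 <= expm (- (tau%:C) *: T) x y.

Section Model.
Variables (R : realType) (d L nt : nat) (beta mu : R).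
Variables (E : 'M[R[i]]_#|Lam d L|).

Local Notation n := #|Lam d L|.
Local Notation C := R[i].

Definition eps : R := beta / nt%:R.

Definition Emu : 'M[C]_n := E - (mu%:C)%:M.

Definition XT := ('I_nt.+1 * 'I_n)%type.
Local Notation N := #|{: XT}|.

(** h = (h_1,...,h_{n_tau}); row k : 'I_nt of the matrix holds h_{k+1}
    (h_0 = 0 never enters K(h)). *)
Definition Kentry (h : 'M[C]_(nt, n)) (p q : XT) : C :=
  let: (j, x) := p in let: (j', x') := q in
  ((j == j') && (x == x'))%:R
  - \sum_(k < nt | (j == k :> nat) && (j' == k.+1 :> nat))
        expm (- (eps%:C) *: Emu) x x'
        * cexp ('i * (Num.sqrt eps)%:C * h k x')
  - [&& (j == nt :> nat), (j' == 0%N :> nat) & (x == x')]%:R.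

Definition Kmx (h : 'M[C]_(nt, n)) : 'M[C]_N :=
  \matrix_(p, q) Kentry h (enum_val p) (enum_val q).

Definition Gmx (h : 'M[C]_(nt, n)) : 'M[C]_N := invmx (Kmx h).

Definition idx (j : 'I_nt.+1) (x : 'I_n) : 'I_N := enum_rank ((j, x) : XT).

End Model.

Definition quadform (R : rcfType) N (K : 'M[R[i]]_N) (a : 'rV[R[i]]_N) : R[i] :=
  (map_mx (@conjc R) a *m K *m a^T) 0 0.

Fixpoint iint_n (R : realType) (n : nat) :
    (('I_n -> R) -> \bar R) -> \bar R :=
  match n return (('I_n -> R) -> \bar R) -> \bar R with
  | 0 => fun f => f (fun _ => 0)
  | n'.+1 => fun f =>
      (\int[@lebesgue_measure R]_t
        iint_n (fun y : 'I_n' -> R =>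
          f (fun i : 'I_n'.+1 =>
               if unlift ord_max i is Some j then y j else t)))%E
  end.

Definition iint (R : realType) (T : finType) (f : (T -> R) -> \bar R) : \bar R :=
  iint_n (fun y : 'I_#|T| -> R => f (fun t => y (enum_rank t))).

Definition gdens (R : realType) (T : finType) (z : T -> R) : R :=
  \prod_(t : T) (expR (- (z t ^+ 2) / 2) / Num.sqrt (pi *+ 2)).

(** a factor B with B B^T = v (exists when v is symmetric psd); the centred
    Gaussian measure mu_v with covariance v is the law of B z, z standard. *)
Definition covfactor (R : realType) n (v : 'M[R]_n) : 'M[R]_n :=
  xget 0 [set B : 'M[R]_n | B *m B^T = v].

(** h = (h_1..h_{n_tau}) distributed as prod_j mu_v(h_j): h_{k,x} = sum_y B_{x y} z_{k,y} *)
Definition hofz (R : realType) nt n (v : 'M[R]_n) (z : 'I_nt * 'I_n -> R)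
  : 'M[R]_(nt, n) :=
  \matrix_(k, x) \sum_y covfactor v x y * z (k, y).

Definition int_muV (R : realType) nt n (v : 'M[R]_n) (F : 'M[R]_(nt, n) -> \bar R)
  : \bar R :=
  iint (fun z : 'I_nt * 'I_n -> R => ((gdens z)%:E * F (hofz v z))%E).

Definition realC (R : realType) m n (h : 'M[R]_(m, n)) : 'M[R[i]]_(m, n) :=
  map_mx (fun r => r%:C) h.

Definition acoord (R : realType) N (u : 'I_N * bool -> R) : 'rV[R[i]]_N :=
  \row_p ((u (p, false)) +i* (u (p, true))).

(** int D a |e^{-(abar, K a)}|, with D a = prod (d abar ^ d a)/(2 pi i)
    = prod dRe a dIm a / pi *)
Definition int_Da_abs (R : realType) N (K : 'M[R[i]]_N) : \bar R :=
  iint (fun u : 'I_N * bool -> R =>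
    ((pi ^+ N)^-1 * complex.Re `| cexp (- quadform K (acoord u)) |)%:E).

(** complex (Frechet) differentiability of f : C^{m x n} -> C at x, over the
    scalar field C; on an open set this is holomorphy = analyticity *)
Definition cdifferentiable (R : realType) m n
  (f : 'M[R[i]]_(m, n) -> (R[i])^o) := fun x => differentiable f x.

(* Main.v *)
Require Import Defs.
From mathcomp Require Import ring lra measurable_realfun.
From mathcomp Require sesquilinear spectral.
Set Implicit Arguments.
Unset Strict Implicit.
Unset Printing Implicit Defensive.
Local Open Scope ring_scope.
Local Open Scope complex_scope.

(** Write K(h) = 1 - S(h).  By the spectral theorem e^{-eps E_mu} has norm at
    most e^{-eps e_min}, and e^{i sqrt(eps) h} has norm at most
    e^{sqrt(eps) max |Im h|}, so in the strip the blocks of S(h) off the closing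
    one have norm at most some c < 1.  Summing the bounds
    |(a_k, X a_{k+1})| <= c (|a_k|^2 + |a_{k+1}|^2) / 2 around the time circle,
    where the closing block contributes (|a_{nt}|^2 + |a_0|^2) / 2, shows that
    the numerical radius of S(h) is at most (1 + c) / 2 < 1.  Hence
    Re (a, K(h) a) >= (1 - c) |a|^2 / 2, with c uniform over real h: this gives
    the Gaussian bound behind the absolute convergence, the invertibility and
    the uniform bound on the inverse, and analyticity follows from Cramer's
    rule.  For the domination, the entries of S(h) are bounded in modulus by
    those of S(0), and a maximum principle for 1 - S(0) passes this on to the
    inverses. *)

(** * The numerical radius and the maximum principle *)

Section NumericalRadius.
Variable R : rcfType.
Local Notation C := R[i].

Definition sqnorm N (a : 'rV[C]_N) : C := \sum_p `|a 0 p| ^+ 2.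

(** The operator norm would not serve: the closing block of S(h) is an identity, so the norm of S(h)
    is at least 1, while its numerical radius is below 1 in the strip. *)
Definition numrad_le N (S : 'M[C]_N) (c : R) :=
  forall a : 'rV[C]_N, `|quadform S a| <= c%:C * sqnorm a.

Lemma conjcE (z : C) : conjc z = (z^*)%R.
Proof. by []. Qed.

Lemma quadformE N (K : 'M[C]_N) a :
  quadform K a = \sum_p \sum_q conjc (a 0 p) * K p q * a 0 q.
Proof.
rewrite /quadform mxE exchange_big /=; apply: eq_bigr => q _.
by rewrite !mxE mulr_suml; apply: eq_bigr => p _; rewrite !mxE.
Qed.

Lemma quadform1 N (a : 'rV[C]_N) : quadform 1%:M a = sqnorm a.
Proof.
rewrite quadformE; apply: eq_bigr => p _; rewrite (bigD1 p) //= big1 => [|q qp].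
  by rewrite mxE eqxx mulr1 addr0 normCK mulrC conjcE.
by rewrite mxE eq_sym (negbTE qp) mulr0 mul0r.
Qed.

Lemma quadformB N (K S : 'M[C]_N) a :
  quadform (K - S) a = quadform K a - quadform S a.
Proof. by rewrite /quadform mulmxBr mulmxBl !mxE. Qed.

Lemma sqnorm_ge0 N (a : 'rV[C]_N) : 0 <= sqnorm a.
Proof. by apply: sumr_ge0 => p _; rewrite exprn_ge0. Qed.

Lemma le_sqnorm N (a : 'rV[C]_N) p : `|a 0 p| ^+ 2 <= sqnorm a.
Proof.
rewrite /sqnorm (bigD1 p) //= lerDl; apply: sumr_ge0 => q _.
by rewrite exprn_ge0.
Qed.

Lemma sqnorm_eq0 N (a : 'rV[C]_N) : sqnorm a <= 0 -> a = 0.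
Proof.
move=> a0; apply/rowP => p; rewrite mxE; apply/eqP.
rewrite -normr_eq0 -sqrf_eq0 eq_le exprn_ge0 // andbT.
exact: le_trans (le_sqnorm a p) a0.
Qed.

Lemma quadform_row_tr N (K : 'M[C]_N) (a : 'rV[C]_N) (b : 'cV[C]_N) :
  K *m a^T = b -> quadform K a = \sum_p conjc (a 0 p) * b p 0.
Proof.
move=> Kab; rewrite /quadform -mulmxA Kab mxE.
by apply: eq_bigr => p _; rewrite mxE.
Qed.

Variables (N : nat) (S : 'M[C]_N) (c : R).
Hypotheses (Sc : numrad_le S c) (c1 : c < 1).

Lemma numrad_coercive (a : 'rV[C]_N) :
  (1 - c)%:C * sqnorm a <= `|quadform (1%:M - S) a|.
Proof.
rewrite quadformB quadform1; apply: le_trans (lerB_dist _ _).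
rewrite rmorphB rmorph1 mulrBl mul1r ger0_norm ?sqnorm_ge0 //.
by rewrite lerB.
Qed.

Lemma numrad_coercive_Re (a : 'rV[C]_N) :
  (1 - c)%:C * sqnorm a <= (complex.Re (quadform (1%:M - S) a))%:C.
Proof.
have := Sc a; rewrite quadformB quadform1.
have: sqnorm a \is Num.real by rewrite ger0_real ?sqnorm_ge0.
case/complex_realP => s ->; case: (quadform S a) => x y.
rewrite normc_def -!rmorphM /= !lecR => h.
have := le_trans (ler_norm x) (le_trans (_ : _ <= _) h).
rewrite -sqrtr_sqr ler_wsqrtr ?lerDl ?sqr_ge0 // => /(_ isT).
by lra.
Qed.

Lemma numrad_unit : 1%:M - S \in unitmx.
Proof.
rewrite -unitmx_tr -row_free_unit; apply/row_freeP/row_freeP/inj_row_free => a a0.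
have: `|quadform (1%:M - S) a| = 0.
  apply/eqP; rewrite normr_eq0 (@quadform_row_tr _ _ _ 0).
    by rewrite big1 // => p _; rewrite mxE mulr0.
  by apply: trmx_inj; rewrite trmx_mul trmxK a0 trmx0.
move=> q0; have := numrad_coercive a; rewrite q0 pmulr_rle0.
  exact: sqnorm_eq0.
by rewrite ltcR subr_gt0.
Qed.

(** With [a] the [q]-th column of the inverse, (1 - S) a is a basis vector and the form equals the
    conjugate of a_q. Coercivity thus gives (1 - c) |a|^2 <= |a_q|, which bounds first |a_q|, then
    |a| and every entry, by 1 / (1 - c). *)
Lemma numrad_inv_bound p q : `|invmx (1%:M - S) p q| <= ((1 - c)^-1)%:C.
Proof.
set G := invmx _; pose a : 'rV[C]_N := (col q G)^T.
have Ka : (1%:M - S) *m a^T = (delta_mx q 0).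
  by rewrite trmxK colE mulmxA mulmxV ?numrad_unit // mul1mx.
have := numrad_coercive a; rewrite (quadform_row_tr Ka) (bigD1 q) //=.
rewrite big1 ?addr0 => [|r rq]; last first.
  by rewrite [delta_mx _ _ _ _]mxE (negbTE rq) mulr0.
rewrite [delta_mx _ _ _ _]mxE !eqxx mulr1 conjcE norm_conjC => h.
have d0 : 0 < (1 - c)%:C :> C by rewrite ltcR subr_gt0.
have hq : `|a 0 q| <= ((1 - c)^-1)%:C.
  have [->|aq0] := eqVneq (a 0 q) 0.
    by rewrite normr0 ler0c invr_ge0 subr_ge0 ltW.
  have := le_trans (ler_wpM2l (ltW d0) (le_sqnorm a q)) h.
  rewrite expr2 mulrA -ler_pdivlMr ?normr_gt0 // divff ?normr_eq0 //.
  by rewrite fmorphV -ler_pdivlMl // mulr1.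
have -> : G p q = a 0 p by rewrite !mxE.
rewrite -(@ler_pXn2r _ 2) ?nnegrE ?normr_ge0 //; last first.
  by rewrite ler0c invr_ge0 subr_ge0 ltW.
apply: le_trans (le_sqnorm a p) _.
rewrite -(ler_pM2l d0); apply: le_trans h _; apply: le_trans hq _.
by rewrite -rmorphXn -rmorphM /= expr2 mulrA mulfV ?mul1r // subr_eq0 gt_eqF.
Qed.

End NumericalRadius.

(** * Entrywise comparison of inverses *)

Section Domination.
Variable R : rcfType.
Local Notation C := R[i].

(* Testing the inequality against the positive part of [y] kills that part. *)
Lemma numrad_max_principle N (t : 'M[R]_N) (c : R) (y : 'I_N -> R) :
  (forall p q, 0 <= t p q) -> numrad_le (map_mx (real_complex R) t) c -> c < 1 ->
  (forall p, y p <= \sum_q t p q * y q) -> forall p, y p <= 0.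
Proof.
move=> t0 tc c1 hy.
pose z p := Num.max (y p) 0.
have z0 p : 0 <= z p by rewrite /z le_max lexx orbT.
have yz p : y p <= z p by rewrite /z le_max lexx.
have zz : \sum_p z p ^+ 2 <= \sum_p \sum_q z p * t p q * z q.
  apply: ler_sum => p _; have -> : z p ^+ 2 = z p * y p.
    by rewrite /z; case: leP => // _; rewrite expr2 !mul0r.
  apply: le_trans (ler_wpM2l (z0 p) (hy p)) _; rewrite mulr_sumr.
  apply: ler_sum => q _; rewrite -mulrA ler_wpM2l // ler_wpM2l //.
have := tc (\row_p (z p)%:C); rewrite quadformE /sqnorm.
under eq_bigr do under eq_bigr do rewrite !mxE conjc_real -!rmorphM.
under eq_bigr do rewrite -rmorph_sum.
rewrite -rmorph_sum.
under [X in _ <= _ * X -> _]eq_bigr do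
  rewrite mxE normc_def /= expr0n addr0 sqrtr_sqr -rmorphXn ger0_norm ?z0 //.
rewrite -rmorph_sum -rmorphM normc_def /= expr0n addr0 sqrtr_sqr lecR.
move=> /(le_trans (ler_norm _)) /(le_trans zz); set s := \sum_p _ => sc.
have s0 : 0 <= s by apply: sumr_ge0 => p _; rewrite exprn_ge0.
have {}s0 : s = 0 by nra.
move=> p; apply: le_trans (yz p) _; rewrite le_eqVlt; apply/orP; left.
rewrite -sqrf_eq0; have := psumr_eq0P _ s0 => -> //= q _; exact: exprn_ge0.
Qed.

(** Column [q] of G = (1 - S)^-1 satisfies |G| <= delta + T |G|, while H = (1 - T)^-1 satisfies H =
    delta + T H, so the maximum principle applies to |G| - H. *)
Lemma invmx_dominated N (S T : 'M[C]_N) (c d : R) :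
  numrad_le S c -> c < 1 -> numrad_le T d -> d < 1 ->
  (forall p q, `|S p q| <= T p q) ->
  forall p q, `|invmx (1%:M - S) p q| <= invmx (1%:M - T) p q.
Proof.
move=> Sc c1 Td d1 ST p q.
pose t : 'M[R]_N := \matrix_(p, q) complex.Re (T p q).
have T0 p' q' : 0 <= T p' q' by exact: le_trans (ST p' q').
have tT : T = map_mx (real_complex R) t.
  by apply/matrixP => p' q'; rewrite !mxE RRe_real // ger0_real.
have t0 p' q' : 0 <= t p' q' by rewrite -ler0c; have := T0 p' q'; rewrite tT mxE.
have fixE (A : 'M[C]_N) : 1%:M - A \in unitmx -> forall p',
    invmx (1%:M - A) p' q = (p' == q)%:R + \sum_r A p' r * invmx (1%:M - A) r q.
  move=> uA p'; have /matrixP/(_ p' q) := mulmxV uA.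
  rewrite mulmxBl mul1mx !mxE => /eqP; rewrite subr_eq => /eqP ->.
  by [].
have uS := numrad_unit Sc c1; have uT := numrad_unit Td d1.
set G := invmx (1%:M - S) in fixE *; set H := invmx (1%:M - T) in fixE *.
pose ReH p' := complex.Re (H p' q); pose ImH p' := complex.Im (H p' q).
have HE p' : ReH p' = (p' == q)%:R + \sum_r t p' r * ReH r /\
    ImH p' = \sum_r t p' r * ImH r.
  have : H p' q = ((p' == q)%:R + \sum_r t p' r * ReH r) +i* (\sum_r t p' r * ImH r).
    rewrite /H (fixE _ uT) [RHS]complexE /= rmorphD rmorph_nat !rmorph_sum.
    rewrite -addrA mulr_sumr -big_split /=.
    congr (_ + _); apply: eq_bigr => r _.
    by rewrite tT !mxE [invmx _ _ _]complexE -tT !rmorphM /= mulrDr [in RHS]mulrCA.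
  by rewrite /ReH /ImH => ->.
rewrite tT in Td.
(* The imaginary part solves the homogeneous equation y = T y; the principle applied to y and to -y
   makes it vanish. *)
have Im0 : ImH p = 0.
  apply/eqP; rewrite eq_le -(oppr_le0 (ImH p)).
  rewrite (numrad_max_principle t0 Td d1 (y := ImH)) => [|r]; last first.
    by have [_ {1}->] := HE r.
  rewrite (numrad_max_principle t0 Td d1 (y := fun r => - ImH r)) // => r.
  by have [_ {1}->] := HE r; rewrite -sumrN; under [leRHS]eq_bigr do rewrite mulrN.
have -> : H p q = (ReH p)%:C by rewrite [LHS]complexE -/(ImH p) Im0 mulr0 addr0.
have absE (z : C) : `|z| = (complex.Re `|z|)%:C :> C by rewrite RRe_real ?normr_real.
rewrite absE lecR -subr_le0.
have maxG := @numrad_max_principle _ t d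
  (fun r => complex.Re `|G r q| - ReH r) t0 Td d1.
apply: (maxG _ p) => r.
under eq_bigr do rewrite mulrBr; rewrite sumrB.
have [{1}-> _] := HE r; rewrite opprD addrA lerD2r lerBlDl.
rewrite -lecR -absE {1}/G (fixE _ uS) rmorphD rmorph_nat rmorph_sum.
apply: le_trans (ler_normD _ _) _; rewrite normr_nat lerD2l.
apply: le_trans (ler_norm_sum _ _ _) _; apply: ler_sum => s _.
rewrite normrM [leRHS]rmorphM. rewrite -[X in _ <= _ * X]absE ler_wpM2r //.
by have := ST r s; rewrite tT mxE.
Qed.

End Domination.

(** * Exponentials of hermitian matrices *)

Lemma conj_diag_mxX (F : fieldType) n (P : 'M[F]_n) (d : 'rV[F]_n) k :
  P \in unitmx ->
  (invmx P *m diag_mx d *m P) ^+ k =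
  invmx P *m diag_mx (\row_i d 0 i ^+ k) *m P.
Proof.
move=> uP; elim: k => [|k IH].
  rewrite expr0 (_ : diag_mx _ = 1%:M) ?mulmx1 ?mulVmx //.
  by apply/matrixP => i j; rewrite !mxE expr0.
rewrite exprSr IH -[LHS]/(_ *m _) !mulmxA mulmxK //.
rewrite -[_ *m diag_mx _ *m diag_mx _]mulmxA mulmx_diag.
congr (_ *m diag_mx _ *m _); apply/rowP => i.
by rewrite !mxE exprSr.
Qed.

Section Expm.
Import sesquilinear spectral.
Variable R : realType.
Local Notation C := R[i].

Lemma cvg_real_complex (u : nat -> R) (l : R) :
  (u @ \oo --> l)%classic ->
  ((fun k => (u k)%:C : C^o) @ \oo --> (l%:C : C^o))%classic.
Proof.
move=> ul; apply/cvgrPdist_lt => e e0.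
have [r re] : exists r, e = r%:C by apply/complex_realP; rewrite gtr0_real.
move: e0; rewrite re ltcR => r0.
move/cvgrPdist_lt : ul => /(_ r r0); apply: filterS => k.
by rewrite -rmorphB normc_def /= expr0n addr0 sqrtr_sqr ltcR.
Qed.

(** The partial sums are combinations of the rank-one matrices [D i], with partial sums of scalar
    exponential series as coefficients. *)
Lemma expm_diagonalizable n (A P : 'M[C]_n) (l : 'I_n -> R) :
  P \in unitmx -> A = invmx P *m diag_mx (\row_i (l i)%:C) *m P ->
  expm A = invmx P *m diag_mx (\row_i (expR (l i))%:C) *m P.
Proof.
move=> uP AE; pose D i : 'M[C]_n := invmx P *m delta_mx i i *m P.
have diagE (f : 'I_n -> R) :
    invmx P *m diag_mx (\row_i (f i)%:C) *m P = \sum_i (f i)%:C *: D i.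
  rewrite diag_mx_sum_delta mulmx_sumr mulmx_suml; apply: eq_bigr => i _.
  by rewrite mxE -scalemxAr -scalemxAl.
have powE k : A ^+ k = invmx P *m diag_mx (\row_i (l i ^+ k)%:C) *m P.
  rewrite AE.
  have h := @conj_diag_mxX C n P (\row_i (l i)%:C) k uP.
  apply: etrans h _; do 2 congr mulmx; congr diag_mx.
  by apply/rowP => i; rewrite !mxE rmorphXn.
rewrite diagE /expm; apply/(@cvg_lim _ (@norm_hausdorff _ _)).
rewrite (_ : (fun N => _) =
    (fun N => \sum_i (series (exp_coeff (l i)) N)%:C *: D i)); last first.
  apply/funext => N; under eq_bigr do rewrite powE diagE scaler_sumr.
  rewrite exchange_big /=; apply: eq_bigr => i _.
  rewrite /series /= rmorph_sum scaler_suml big_mkord; apply: eq_bigr => k _.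
  by rewrite exp_coeffE /= scalerA rmorphM fmorphV rmorph_nat.
apply: cvg_big => [|i _]; first exact: add_continuous.
apply: cvgZr_tmp; apply: cvg_real_complex.
exact: is_cvg_series_exp_coeff.
Qed.

(** Besides the spectral theorem, this records that each [l i] is an eigenvalue, with row [i] of [P]
    as left eigenvector; the comparison with [emin] rests on that. *)
Lemma hermitian_diagonalization n (A : 'M[C]_n) : Defs.hermitian A ->
  exists P : 'M[C]_n, exists l : 'I_n -> R,
    [/\ P \is unitarymx, A = invmx P *m diag_mx (\row_i (l i)%:C) *m P
      & forall i, eigenvalue A (l i)%:C].
Proof.
move=> hA.
have hA' : A \is hermsymmx.
  apply/(is_hermitianmxP _ conjc); rewrite expr0 scale1r.
  by apply/matrixP => i j; have /matrixP/(_ j i) := hA; rewrite !mxE.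
have /orthomx_spectralP AE := hermitian_normalmx hA'.
have /mxOverP lr := hermitian_spectral_diag_real hA'.
pose l i := complex.Re (spectral_diag A 0 i).
have lE : spectral_diag A = \row_i (l i)%:C.
  by apply/rowP => i; rewrite mxE RRe_real // lr.
exists (spectralmx A), l; split; rewrite -?lE //; first exact: spectral_unitarymx.
move=> i; have uP := unitarymx_unit (spectral_unitarymx A).
apply/eigenvalueP; exists (row i (spectralmx A)).
  rewrite -row_mul {2}AE !mulmxA mulmxV // mul1mx row_mul row_diag_mx lE mxE.
  by rewrite -scalemxAl -rowE.
apply: contraTneq uP => r0; rewrite -row_free_unit -kermx_eq0.
apply: contraTneq isT => k0; have : delta_mx 0 i = 0 :> 'rV[C]_n.
  apply/eqP; rewrite -submx0 -k0; apply/sub_kermxP; by rewrite -rowE.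
by move/rowP/(_ i)/eqP; rewrite !mxE !eqxx oner_eq0.
Qed.

(** [eigenvalue] provides a row vector u with u A = l u, and [posdef] conjugates its left argument;
    testing on the conjugate of u gives l |u|^2 > 0. *)
Lemma posdef_eigenvalue_gt0 n (A : 'M[C]_n) (l : R) :
  posdef A -> eigenvalue A l%:C -> 0 < l.
Proof.
move=> pA /eigenvalueP [u uA u0].
have := pA (map_mx (@conjc R) u).
have -> : map_mx (@conjc R) (map_mx (@conjc R) u) = u.
  by apply/matrixP => i j; rewrite !mxE conjcK.
rewrite uA -scalemxAl mxE => h.
have u0' : map_mx (@conjc R) u != 0.
  apply: contraNneq u0 => /rowP c0; apply/eqP/rowP => i.
  rewrite [RHS]mxE; apply/eqP; rewrite -conjc_eq0.
  by have := c0 i; rewrite !mxE => ->.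
have {h} := h u0'; set s := (_ *m _) 0 0.
have s0 : 0 <= s.
  rewrite /s mxE; apply: sumr_ge0 => i _; rewrite !mxE; exact: mulcJ_ge0.
have /complex_realP [t tE] : s \is Num.real by rewrite ger0_real.
move: s0; rewrite tE -rmorphM ler0c ltcR => t0 h.
by rewrite ltNge; apply: contraTN h => l0; rewrite -leNgt mulr_le0_ge0.
Qed.

End Expm.

(** * Numerical radius of the time-shift operator *)

Lemma scalemx_sandwich (F : comPzRingType) n (c : F) (A B D : 'M[F]_n) :
  c *: (A *m B *m D) = A *m (c *: B) *m D.
Proof. by rewrite scalemxAl scalemxAr. Qed.

(** * Form bounds for the exponential of a hermitian matrix *)

Section FormBound.
Import sesquilinear spectral.
Variable R : realType.
Local Notation C := R[i].

(** By rescaling [u] and [w] inversely to each other, this amounts to an operator norm at most [c];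
    the symmetric form is the one that adds up around the time circle. *)
Definition form_le n (X : 'M[C]_n) (c : R) := forall u w : 'I_n -> C,
  `|\sum_x \sum_y conjc (u x) * X x y * w y| *+ 2
    <= c%:C * (\sum_x `|u x| ^+ 2 + \sum_y `|w y| ^+ 2).

Lemma sqnormE N (a : 'rV[C]_N) : sqnorm a = (map_mx (@conjc R) a *m a^T) 0 0.
Proof. by rewrite -quadform1 /quadform mulmx1. Qed.

Lemma sqnorm_unitary n (P : 'M[C]_n) (a : 'rV[C]_n) :
  P \is unitarymx -> sqnorm (a *m P^T) = sqnorm a.
Proof.
move=> /unitarymxP /mulmx1C uP; rewrite !sqnormE map_mxM trmx_mul trmxK.
rewrite mulmxA -[_ *m _ *m P]mulmxA.
by rewrite (_ : map_mx _ P^T *m P = 1%:M) ?mulmx1.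
Qed.

(** In the eigenbasis the form is diagonal, and 2 |a_i| |b_i| <= |a_i|^2 + |b_i|^2 concludes
    coordinate by coordinate. *)
Lemma form_le_diag n (P : 'M[C]_n) (e : 'I_n -> R) (c : R) :
  P \is unitarymx -> (forall i, 0 <= e i <= c) ->
  form_le (invmx P *m diag_mx (\row_i (e i)%:C) *m P) c.
Proof.
move=> uP ec u w.
pose a : 'rV[C]_n := \row_i u i; pose b : 'rV[C]_n := \row_i w i.
pose a' := a *m P^T; pose b' := b *m P^T.
have -> : \sum_x `|u x| ^+ 2 = sqnorm a' :> C.
  by rewrite sqnorm_unitary //; apply: eq_bigr => i _; rewrite mxE.
have -> : \sum_x `|w x| ^+ 2 = sqnorm b' :> C.
  by rewrite sqnorm_unitary //; apply: eq_bigr => i _; rewrite mxE.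
have -> : \sum_x \sum_y conjc (u x) *
      (invmx P *m diag_mx (\row_i (e i)%:C) *m P) x y * w y
    = \sum_i conjc (a' 0 i) * (e i)%:C * b' 0 i.
  transitivity ((map_mx (@conjc R) a' *m diag_mx (\row_i (e i)%:C) *m b'^T) 0 0).
    rewrite /a' /b' map_mxM trmx_mul trmxK.
    have -> : map_mx (@conjc R) P^T = invmx P by rewrite invmx_unitary.
    rewrite mulmxA -(mulmxA (map_mx _ _)) -(mulmxA (map_mx _ _)).
    set X := _ *m _ *m P.
    rewrite mxE exchange_big /=; apply: eq_bigr => y _.
    rewrite !mxE mulr_suml; apply: eq_bigr => x _.
    by rewrite !mxE.
  by rewrite mul_mx_diag mxE; apply: eq_bigr => i _; rewrite !mxE.
rewrite -mulr_natr; apply: le_trans (ler_wpM2r _ (ler_norm_sum _ _ _)) _ => //.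
rewrite mulr_suml -big_split mulr_sumr /=; apply: ler_sum => i _.
have /andP[e0 e1] := ec i; rewrite !normrM conjcE norm_conjC.
have -> : `|(e i)%:C| = (e i)%:C :> C by rewrite ger0_norm ?ler0c.
rewrite mulr_natr mulrAC mulrC -mulrnAr; apply: ler_pM; rewrite ?ler0c ?lecR //.
by have [] := real_leif_mean_square_scaled (normr_real (a' 0 i))
  (normr_real (b' 0 i)).
Qed.

(** The eigenvalues are produced before [e] and [t], so that one family serves both for some lower
    bound of the spectrum and for [emin]. *)
Lemma form_le_expm n (A : 'M[C]_n) : Defs.hermitian A ->
  exists l : 'I_n -> R, (forall i, eigenvalue A (l i)%:C) /\
    forall e t : R, 0 <= t -> (forall i, e <= l i) ->
      form_le (expm (- (t%:C) *: A)) (expR (- (t * e))).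
Proof.
move=> /hermitian_diagonalization [P [l [uP AE lA]]]; exists l; split=> // e t t0 el.
rewrite (@expm_diagonalizable _ _ _ P (fun i => - (t * l i))).
- apply: form_le_diag => // i; rewrite expR_ge0 ler_expR lerN2.
  by rewrite ler_wpM2l.
- exact: unitarymx_unit.
have -> : diag_mx (\row_i (- (t * l i))%:C) =
    - t%:C *: diag_mx (\row_i (l i)%:C) :> 'M[C]_n.
  by apply/matrixP => i j; rewrite !mxE rmorphN rmorphM mulrnAr mulNr.
by rewrite -scalemx_sandwich -AE.
Qed.

End FormBound.

(** * Block structure of S(h) and the sum around the time circle *)

Section ModelBound.
Variables (R : realType) (d L nt : nat) (beta mu : R).
Variables (E : 'M[R[i]]_#|Lam d L|).
Local Notation n := #|Lam d L|.
Local Notation C := R[i].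
Local Notation XT := ('I_nt.+1 * 'I_n)%type.
Local Notation N := #|{: XT}|.
Local Notation ep := (eps nt beta).
Local Notation X := (expm (- (ep%:C) *: Emu mu E)).

Definition phase (h : 'M[C]_(nt, n)) k x := cexp ('i * (Num.sqrt ep)%:C * h k x).

(** At most one [k] contributes, linking time [k] to time [k.+1], whose field is row [k] of [h]. The
    last term joins time [nt] back to time 0. *)
Definition Sentry (h : 'M[C]_(nt, n)) (p q : XT) : C :=
  \sum_(k < nt | (p.1 == k :> nat) && (q.1 == k.+1 :> nat))
     X p.2 q.2 * phase h k q.2
  + [&& (p.1 == nt :> nat), (q.1 == 0%N :> nat) & (p.2 == q.2)]%:R.

Definition Smx (h : 'M[C]_(nt, n)) : 'M[C]_N :=
  \matrix_(p, q) Sentry h (enum_val p) (enum_val q).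

Lemma Kmx_Smx h : Kmx beta mu E h = 1%:M - Smx h.
Proof.
apply/matrixP => p q; rewrite !mxE -(inj_eq enum_val_inj).
case: (enum_val p) => j x; case: (enum_val q) => j' x'.
by rewrite xpair_eqE /Kentry /Sentry opprD addrA.
Qed.

Lemma sum_fst_eq (I J : finType) (V : nmodType) (i : I) (f : I * J -> V) :
  \sum_(p | p.1 == i) f p = \sum_x f (i, x).
Proof.
rewrite (eq_bigl (fun p : I * J => (p.1 == i) && true)) => [|p]; last first.
  by rewrite andbT.
rewrite (eq_bigr (fun p => f (p.1, p.2))) => [|[]] //.
by rewrite -(pair_big (fun j => j == i) predT (fun j x => f (j, x))) big_pred1_eq.
Qed.

(** The phase is attached to the right-hand vector, so that [form_le] for the bare exponential
    applies to each link. *)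
Lemma quadform_Smx h (a : 'rV[C]_N) :
  let b (p : XT) := a 0 (enum_rank p) in
  quadform (Smx h) a =
  \sum_(k < nt) (\sum_x \sum_y conjc (b (widen_ord (leqnSn nt) k, x)) * X x y
        * (phase h k y * b (lift ord0 k, y)))
  + \sum_x conjc (b (ord_max, x)) * b (ord0, x).
Proof.
move=> b; rewrite quadformE (reindex _ (onW_bij _ (@enum_rank_bij XT))) /=.
under eq_bigr do rewrite (reindex _ (onW_bij _ (@enum_rank_bij XT))) /=.
under eq_bigr do under eq_bigr do
  rewrite mxE !enum_rankK -/(b _) mulrDr mulrDl mulr_sumr mulr_suml.
under eq_bigr do rewrite big_split /=.
rewrite big_split /=; congr (_ + _).
  under eq_bigr do under eq_bigr do rewrite big_mkcond /=.
  under eq_bigr do rewrite exchange_big /=.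
  rewrite exchange_big /=; apply: eq_bigr => k _.
  rewrite -(sum_fst_eq (widen_ord (leqnSn nt) k)
    (fun p => \sum_y conjc (b p) * X p.2 y * (phase h k y * b (lift ord0 k, y)))).
  rewrite [RHS]big_mkcond /=; apply: eq_bigr => p _.
  have -> : (p.1 == widen_ord (leqnSn nt) k) = (p.1 == k :> nat) by [].
  case: eqP => _ /=; last by rewrite big1.
  rewrite -big_mkcond /= -(sum_fst_eq (lift ord0 k)
    (fun q => conjc (b p) * X p.2 q.2 * (phase h k q.2 * b q))).
  apply: eq_big => [q|q _].
    by rewrite -[RHS]val_eqE /= /bump leq0n add1n.
  by rewrite !mulrA.
rewrite -(sum_fst_eq ord_max (fun p => conjc (b p) * b (ord0, p.2))).
rewrite [RHS]big_mkcond /=; apply: eq_bigr => p _.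
rewrite -[p.1 == ord_max]val_eqE /=; case: eqP => _ /=; last first.
  by rewrite big1 // => q _; rewrite mulr0 mul0r.
rewrite (bigD1 (ord0, p.2)) //= !eqxx mulr1 big1 ?addr0 // => -[j y].
rewrite xpair_eqE -val_eqE /= => /negbTE; rewrite [y == _]eq_sym => ->.
by rewrite mulr0 mul0r.
Qed.

Lemma numrad_Smx h (c0 M : R) :
  (0 < nt)%N -> form_le X c0 -> 0 <= c0 -> 0 < M -> c0 * M <= 1 ->
  (forall k x, `|phase h k x| <= M%:C) ->
  numrad_le (Smx h) ((1 + c0 * M) / 2).
Proof.
move=> nt0 Xc c00 M0 cM1 hM a; rewrite quadform_Smx.
set b := fun p : XT => a 0 (enum_rank p).
pose m j := \sum_x `|b (j, x)| ^+ 2.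
have m0 j : 0 <= m j by apply: sumr_ge0 => x _; rewrite exprn_ge0.
have -> : sqnorm a = \sum_j m j.
  rewrite /sqnorm (reindex _ (onW_bij _ (@enum_rank_bij XT))) /= /m pair_bigA.
  by apply: eq_bigr => -[].
have MC : 0 < M%:C :> C by rewrite ltcR.
have blk (k : 'I_nt) :
    `|\sum_x \sum_y conjc (b (widen_ord (leqnSn nt) k, x)) * X x y
        * (phase h k y * b (lift ord0 k, y))| *+ 2
    <= (c0 * M)%:C * (m (widen_ord (leqnSn nt) k) + m (lift ord0 k)).
  (* The phase divided by [M] does not lengthen the vector it multiplies, and the factor [M] taken
     out enters linearly. *)
  have -> : \sum_x \sum_y conjc (b (widen_ord (leqnSn nt) k, x)) * X x y
        * (phase h k y * b (lift ord0 k, y)) =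
      M%:C * \sum_x \sum_y conjc (b (widen_ord (leqnSn nt) k, x)) * X x y
        * (M%:C^-1 * phase h k y * b (lift ord0 k, y)).
    rewrite mulr_sumr; apply: eq_bigr => x _; rewrite mulr_sumr.
    apply: eq_bigr => y _; rewrite [RHS]mulrCA; congr (_ * _).
    by rewrite !mulrA divff ?mul1r // gt_eqF.
  rewrite normrM gtr0_norm // -mulrnAr [(c0 * M)%:C]rmorphM /=.
  rewrite (mulrC c0%:C) -mulrA ler_pM2l //.
  apply: le_trans (Xc _ _) _; rewrite ler_wpM2l ?ler0c // lerD2l.
  apply: ler_sum => y _; rewrite lerXn2r ?nnegrE // normrM ler_piMl //.
  have -> : `|M%:C^-1 * phase h k y| = M%:C^-1 * `|phase h k y|.
    by rewrite normrM normfV (gtr0_norm MC).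
  by rewrite mulrC ler_pdivrMr // mul1r.
have ends : `|\sum_x conjc (b (ord_max, x)) * b (ord0, x)| *+ 2
    <= m ord_max + m ord0.
  rewrite -mulr_natr; apply: le_trans (ler_wpM2r _ (ler_norm_sum _ _ _)) _ => //.
  rewrite mulr_suml -big_split /=; apply: ler_sum => x _.
  rewrite normrM conjcE norm_conjC mulr_natr.
  by have [] := real_leif_mean_square_scaled (normr_real (b (ord_max, x)))
    (normr_real (b (ord0, x))).
rewrite -(@ler_pMn2r _ 2) //.
(* Each time slice lies in two of the [nt] forward links, except the slices 0 and [nt], which lie in
   one each. *)
apply: le_trans (_ : _ <= (c0 * M)%:C * ((\sum_j m j) *+ 2 - (m ord_max + m ord0))
   + (m ord_max + m ord0)) _.
  rewrite -[leLHS]mulr_natr; apply: le_trans (ler_wpM2r _ (ler_normD _ _)) _ => //.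
  rewrite mulrDl !mulr_natr lerD //.
  rewrite -[leLHS]mulr_natr; apply: le_trans (ler_wpM2r _ (ler_norm_sum _ _ _)) _ => //.
  rewrite mulr_suml; under eq_bigr do rewrite mulr_natr.
  apply: le_trans (ler_sum _ (fun k _ => blk k)) _.
  rewrite -mulr_sumr big_split /= mulr2n {1}big_ord_recr /= big_ord_recl /=.
  suff -> : forall (F : comPzRingType) (u v w z : F),
    (u + v) + (w + z) - (v + w) = u + z by [].
  by move=> F u v w z; ring.
(* Since [nt] is positive, the times 0 and [nt] give distinct terms of the sum. *)
have mm : m ord_max + m ord0 <= \sum_j m j.
  rewrite big_ord_recl addrC lerD2l.
  have k0 : (nt.-1 < nt)%N by rewrite prednK.
  rewrite (bigD1 (Ordinal k0)) //= (_ : lift _ _ = ord_max).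
    by rewrite lerDl sumr_ge0.
  by apply: ord_inj; rewrite lift0 /= prednK.
have -> : (((1 + c0 * M) / 2)%:C * \sum_j m j) *+ 2 = (1 + (c0 * M)%:C) * \sum_j m j.
  transitivity ((1 + c0 * M)%:C * \sum_j m j); last by rewrite rmorphD.
  rewrite -mulrnAl -rmorphMn; congr (_%:C * _).
  by rewrite -mulr_natr divfK.
rewrite -subr_ge0.
(* With g = c0 M, u the full sum and v its two end terms, the gap is a product of nonnegative
   factors. *)
suff -> : forall (F : comPzRingType) (g u v : F),
    (1 + g) * u - (g * (u *+ 2 - v) + v) = (1 - g) * (u - v).
  rewrite mulr_ge0 ?subr_ge0 // -(rmorph1 (real_complex R)) lecR.
  exact: cM1.
by move=> F g u v; ring.
Qed.

End ModelBound.

(** * Complex differentiability *)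

Section Differentiability.
Variables (K : numFieldType) (V : normedModType K).

Lemma differentiable_bigsum (I : Type) (r : seq I) (f : I -> V -> K) (x : V) :
  (forall i, differentiable (f i) x) ->
  differentiable (fun y => \sum_(i <- r) f i y) x.
Proof.
move=> df; elim: r => [|i r IH].
  rewrite (_ : (fun y => _) = cst 0); first exact: differentiable_cst.
  by apply/funext => y; rewrite big_nil.
rewrite (_ : (fun y => _) = f i + (fun y => \sum_(i <- r) f i y)).
  exact: differentiableD.
by apply/funext => y; rewrite big_cons.
Qed.

Lemma differentiable_bigprod (I : Type) (r : seq I) (f : I -> V -> K) (x : V) :
  (forall i, differentiable (f i) x) ->
  differentiable (fun y => \prod_(i <- r) f i y) x.
Proof.
move=> df; elim: r => [|i r IH].
  rewrite (_ : (fun y => _) = cst 1); first exact: differentiable_cst.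
  by apply/funext => y; rewrite big_nil.
rewrite (_ : (fun y => _) = f i * (fun y => \prod_(i <- r) f i y)).
  exact: differentiableM.
by apply/funext => y; rewrite big_cons.
Qed.

Lemma differentiable_det n (F : V -> 'M[K]_n) (x : V) :
  (forall i j, differentiable (fun y => F y i j) x) ->
  differentiable (fun y => \det (F y)) x.
Proof.
move=> dF; apply: differentiable_bigsum => s.
apply: (@differentiableM _ _ (cst _)); first exact: differentiable_cst.
exact: differentiable_bigprod.
Qed.

(** Cramer's formula is available for [invmx] only where the determinant is nonzero, so
    differentiability has to be carried along an equality near a point. *)
Lemma near_eq_differentiable (W : normedModType K) (f g : V -> W) (x : V) :
  (\forall y \near x, f y = g y) -> differentiable f x -> differentiable g x.
Proof.
move=> fg df.
have fgx : f x = g x by exact: nbhs_singleton fg.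
have /diffP[dc dE] := df; apply/diffP => /=.
(* ['d g x] is a choice among the linear maps with this property, so exhibiting one suffices; the
   differential of [f] is one. *)
apply: (@getPex _ (fun (dg : {linear V -> W}) => continuous dg /\
  forall y, g y = g (lim (nbhs x)) + dg (y - lim (nbhs x))
                  +o_(y \near x) (y - lim (nbhs x)))).
exists ('d f x); split=> //.
set c := lim (nbhs x) in dE *.
have Ef : f = (fun y => f c + 'd f x (y - c)) +o_ (nbhs x) (fun y => y - c).
  by apply/funext => y; rewrite [LHS]dE.
have Eg : g = (fun y => g c + 'd f x (y - c)) +o_ (nbhs x) (fun y => y - c).
  apply/eqaddoP => e e0; move/eqaddoP : Ef => /(_ e e0).
  apply: filterS2 fg => y fgy.
  have -> : c = x by rewrite /c lim_id.
  by rewrite -[(f - _) y]/(f y - _) -[(g - _) y]/(g y - _) fgx fgy.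
by apply: eqaddoEx => y; rewrite [LHS](congr1 (fun k => k y) Eg).
Qed.

Lemma differentiable_invmx n (F : V -> 'M[K]_n) (x : V) p q :
  (forall i j, differentiable (fun y => F y i j) x) -> F x \in unitmx ->
  differentiable (fun y => invmx (F y) p q) x.
Proof.
move=> dF uF; have dd := differentiable_det dF.
have d0 : \det (F x) != 0 by rewrite -unitfE.
apply: (@near_eq_differentiable _ (fun y => (\det (F y))^-1 * \adj (F y) p q)).
  have := differentiable_continuous dd.
  (* A number closer to det (F x) than |det (F x)| is nonzero, so [F y] is invertible near [x]. *)
  move=> /cvgrPdist_lt/(_ `|\det (F x)|).
  rewrite normr_gt0 d0 => /(_ isT); apply: filterS => y dy.
  have uy : F y \in unitmx.
    rewrite unitmxE unitfE; apply: contraTneq dy => ->.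
    by rewrite subr0 ltxx.
  by rewrite /invmx uy [RHS]mxE.
apply: differentiableM; first exact: differentiableV.
rewrite (_ : (fun y => _) = fun y => (-1) ^+ (q + p) * \det (row' q (col' p (F y)))).
  apply: (@differentiableM _ _ (cst _)); first exact: differentiable_cst.
  apply: differentiable_det => i j.
  have -> : (fun y => row' q (col' p (F y)) i j) =
      (fun y => F y (lift q i) (lift p j)).
    by apply/funext => y; rewrite !mxE.
  exact: dF.
by apply/funext => y; rewrite mxE.
Qed.

End Differentiability.

(** * Complex differentiability of the exponential *)

Section ComplexExponential.
Local Open Scope complex_scope.
Variable R : realType.
Local Notation C := R[i].

Lemma linear_approx_at0 (f : R -> R) (l e : R) :
  is_derive (0 : R) 1 f l -> 0 < e ->
  \forall x \near (0 : R), `|f x - f 0 - l * x| <= e * `|x|.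
Proof.
move=> [df dl] e0; have := derivable_nbhs df; rewrite dl.
move=> /eqaddoP/(_ e e0); apply: filterS => x.
rewrite -[(_ - _) x]/(f (x * 1 + 0) - (f 0 + x * l)) mulr1 addr0.
by rewrite opprD addrA [x * l]mulrC.
Qed.


Lemma norm_cexp (z : R[i]) : `|cexp z| = (expR (complex.Re z))%:C.
Proof.
case: z => x y; rewrite /cexp /=.
have -> : ((cos y)%:C + 'i * (sin y)%:C)%R = Complex (cos y) (sin y) :> R[i].
  by rewrite [RHS]complexE.
rewrite normrM !normc_def /= expr0n addr0 sqrtr_sqr ger0_norm ?expR_ge0 //.
by rewrite cos2Dsin2 sqrtr1 mulr1.
Qed.

Lemma norm_Re_le (z : C) : `|complex.Re z|%:C <= `|z|.
Proof.
case: z => a b; rewrite normc_def lecR -sqrtr_sqr ler_wsqrtr //=.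
by rewrite lerDl sqr_ge0.
Qed.

Lemma norm_Im_le (z : C) : `|complex.Im z|%:C <= `|z|.
Proof.
case: z => a b; rewrite normc_def lecR -sqrtr_sqr ler_wsqrtr //=.
by rewrite lerDr sqr_ge0.
Qed.

Lemma norm_le_ReIm (z : C) : `|z| <= (`|complex.Re z| + `|complex.Im z|)%:C.
Proof.
rewrite [z in leLHS]complexE; apply: le_trans (ler_normD _ _) _.
rewrite normrM rmorphD !normc_def /= !expr0n /= expr1n add0r sqrtr1 !addr0.
by rewrite !sqrtr_sqr mul1r.
Qed.

Lemma cexpE (z : C) : cexp z =
  (expR (complex.Re z) * cos (complex.Im z)) +i*
  (expR (complex.Re z) * sin (complex.Im z)).
Proof.
rewrite /cexp [RHS]complexE /= !rmorphM mulrDr; congr (_ + _).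
by rewrite mulrCA.
Qed.

Lemma cexpD (z w : C) : cexp (z + w) = cexp z * cexp w.
Proof.
case: z => a b; case: w => c d; rewrite !cexpE /= expRD sinD cosD.
by congr (_ +i* _); ring.
Qed.

Lemma cexp0 : cexp 0 = 1 :> C.
Proof. by rewrite cexpE /= expR0 cos0 sin0 mul1r mulr0. Qed.

(** With h = x + iy, the first-order expansions of exp, cos and sin at 0 combine to e^h = 1 + h +
    o(h). *)
Lemma cexp_approx_at0 (e : R) : 0 < e -> exists2 r : R, 0 < r &
  forall h : C, `|h| < r%:C -> `|cexp h - 1 - h| <= e%:C * `|h|.
Proof.
(* The four error terms below weigh 3, 1, 3 and 2 times e' |h|, whence the 9; the bound e' <= 1
   yields e^x <= 3. *)
move=> e0; have e60 : 0 < Num.min (e / 9) 1.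
  by rewrite lt_min ltr01 divr_gt0.
set e' := Num.min _ _ in e60.
have e'1 : e' <= 1 by rewrite ge_min lexx orbT.
have e'e : e' <= e / 9 by rewrite ge_min lexx.
clearbody e'.
have [r1 r10 hE] : exists2 r : R, 0 < r & forall x : R, `|x| < r ->
    [/\ `|expR x - 1 - x| <= e' * `|x|, `|cos x - 1| <= e' * `|x|
      & `|sin x - x| <= e' * `|x| ].
  have h1 := linear_approx_at0 (is_derive_expR (0 : R)) e60.
  have h2 := linear_approx_at0 (is_derive_cos (0 : R)) e60.
  have h3 := linear_approx_at0 (is_derive_sin (0 : R)) e60.
  have [r /= r0 hr] : nbhs (0 : R) [set x | [/\ `|expR x - 1 - x| <= e' * `|x|,
      `|cos x - 1| <= e' * `|x| & `|sin x - x| <= e' * `|x| ] ]%classic.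
    move: h1 h2 h3; apply: filterS3 => x; rewrite expR0 cos0 sin0 oppr0.
    by rewrite mul0r !subr0 addr0 !mul1r => ? ? ?; split.
  exists r => // x xr; apply: hr => /=.
  by rewrite /ball_ /= sub0r normrN.
(* A radius at most [e'] makes the second-order product (e^x - 1) y at most 2 e' |h|. *)
exists (Num.min r1 e'); first by rewrite lt_min r10.
move=> h hr; apply: le_trans (norm_le_ReIm _) _.
have hRe := le_lt_trans (norm_Re_le h) hr.
have hIm := le_lt_trans (norm_Im_le h) hr.
rewrite !ltcR !lt_min in hRe hIm.
have /complex_realP[s sE] : `|h| \is Num.real by rewrite normr_real.
move: (norm_Re_le h) (norm_Im_le h); rewrite sE -rmorphM !lecR.
rewrite cexpE; case: h hr sE hRe hIm => x y /= _ _ /andP[xr x1] /andP[yr y1] xs ys.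
have [Ex _ _] := hE x xr; have [_ Cy Sy] := hE y yr.
rewrite oppr0 !addr0.
have {}x1 := lt_le_trans x1 e'1.
have Ex2 : expR x <= 3.
  move: Ex; rewrite ler_norml => /andP[_].
  have := ler_norm x; nra.
have Ex0 := expR_gt0 x.
have Ex1 : `|expR x - 1| <= 2 * `|x|.
  rewrite -[_ - 1](subrK x); apply: le_trans (ler_normD _ _) _.
  rewrite mulrDl mul1r lerD2r; apply: le_trans Ex _.
  by rewrite ler_piMl.
have -> : expR x * cos y - 1 - x = expR x * (cos y - 1) + (expR x - 1 - x) by ring.
have -> : expR x * sin y - y = expR x * (sin y - y) + (expR x - 1) * y by ring.
have sy0 := normr_ge0 y; have sx0 := normr_ge0 x.
have A1 : `|expR x * (cos y - 1)| <= 3 * (e' * s).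
  rewrite normrM (ger0_norm (ltW Ex0)); apply: ler_pM => //.
  by apply: le_trans Cy _; rewrite ler_wpM2l // ltW.
have A2 : `|expR x - 1 - x| <= e' * s.
  by apply: le_trans Ex _; rewrite ler_wpM2l // ltW.
have A3 : `|expR x * (sin y - y)| <= 3 * (e' * s).
  rewrite normrM (ger0_norm (ltW Ex0)); apply: ler_pM => //.
  by apply: le_trans Sy _; rewrite ler_wpM2l // ltW.
have A4 : `|(expR x - 1) * y| <= 2 * (e' * s).
  rewrite normrM (mulrC e') mulrA; apply: ler_pM => //; last exact: ltW.
  by apply: le_trans Ex1 _; rewrite ler_wpM2l.
apply: (@le_trans _ _ (9 * e' * s)); last first.
  rewrite ler_wpM2r ?(le_trans sx0 xs) //; lra.
have := ler_normD (expR x * (cos y - 1)) (expR x - 1 - x).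
have := ler_normD (expR x * (sin y - y)) ((expR x - 1) * y).
lra.
Qed.

(** The functional equation reduces the derivative at [z] to the expansion at 0: (e^(z+h) - e^z) / h
    - e^z = e^z (e^h - 1 - h) / h. *)
Lemma differentiable_cexp (z : C) :
  differentiable (fun w : C^o => cexp w : C^o) (z : C^o).
Proof.
apply/derivable1_diffP/cvg_ex; exists (cexp z : C^o).
apply/cvgrPdist_le => e e0.
have /complex_realP[r re] : (e : C) \is Num.real by exact: gtr0_real.
have r0 : 0 < r by rewrite -ltcR -re.
have M0 : 0 < expR (complex.Re z) by exact: expR_gt0.
have [s s0 hs] := @cexp_approx_at0 (r / expR (complex.Re z)) (divr_gt0 r0 M0).
rewrite /= near_withinE; apply/nbhs_ballP; exists s%:C; rewrite /= ?ltcR //.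
move=> h; rewrite /ball /= sub0r normrN => hlt h0.
rewrite [h%:A]mulr1 cexpD -[_ *: _]/(_ * _).
have gen (F : fieldType) (k a b : F) : k != 0 ->
    b - k^-1 * (a * b - b) = - (k^-1 * b * (a - 1 - k)) by move=> ?; field.
suff: `|(cexp z - h^-1 * (cexp h * cexp z - cexp z) : C)| <= e by [].
rewrite gen // normrN normrM (normrM h^-1) normfV norm_cexp re.
rewrite -mulrA ler_pdivrMl ?normr_gt0 //.
apply: le_trans (ler_wpM2l _ (hs h hlt)) _; first by rewrite ler0c ltW.
by rewrite mulrA -rmorphM mulrCA divff ?mulr1 ?gt_eqF // mulrC.
Qed.

End ComplexExponential.

(** * Iterated Gaussian integrals *)

Section IteratedIntegral.
Variable R : realType.

(* No measurability: for nonnegative functions the integral is a supremum over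
   the simple functions below the integrand. *)
Lemma integral_le_ge0 (f g : R -> \bar R) :
  (forall x, 0 <= f x)%E -> (forall x, f x <= g x)%E ->
  (\int[@lebesgue_measure R]_x f x <= \int[@lebesgue_measure R]_x g x)%E.
Proof.
move=> f0 fg; have g0 x : (0 <= g x)%E by exact: le_trans (f0 x) (fg x).
rewrite !ge0_integralTE //; apply: le_ereal_sup => _ [h hf <-].
by exists h => // x; exact: le_trans (hf x) (fg x).
Qed.

Lemma iint_n_ge0 n (f : ('I_n -> R) -> \bar R) :
  (forall y, 0 <= f y)%E -> (0 <= iint_n f)%E.
Proof.
elim: n f => [|n IH] f f0 /=; first exact: f0.
by apply: integral_ge0 => t _; apply: IH => y; exact: f0.
Qed.

Lemma iint_n_le n (f g : ('I_n -> R) -> \bar R) :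
  (forall y, 0 <= f y)%E -> (forall y, f y <= g y)%E ->
  (iint_n f <= iint_n g)%E.
Proof.
elim: n f g => [|n IH] f g f0 fg /=; first exact: fg.
apply: integral_le_ge0 => t; first by apply: iint_n_ge0 => y; exact: f0.
by apply: IH => y; [exact: f0|exact: fg].
Qed.

(** The constant [c] varies in the induction: the factor of the outermost variable is absorbed into
    it before the inner integral is evaluated. *)
Lemma iint_n_prod n (g : R -> R) (I c : R) :
  measurable_fun setT g -> (forall x, 0 <= g x) -> 0 <= c ->
  (\int[@lebesgue_measure R]_x (g x)%:E = I%:E)%E ->
  (iint_n (fun y : 'I_n -> R => (c * \prod_i g (y i))%:E) = (c * I ^+ n)%:E)%E.
Proof.
move=> mg g0 c0 gI; have I0 : 0 <= I.
  by rewrite -lee_fin -gI; apply: integral_ge0 => x _; rewrite lee_fin.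
elim: n c c0 => [|n IH] c c0 /=; first by rewrite big_ord0.
transitivity (\int[@lebesgue_measure R]_t ((c * I ^+ n)%:E * (g t)%:E))%E.
  apply: eq_integral => t _; rewrite -EFinM mulrAC -IH ?mulr_ge0 //.
  congr iint_n; apply/funext => y; congr (_%:E).
  rewrite big_ord_recr /= unlift_none [X in _ * X = _]mulrC mulrA.
  congr (_ * _); apply: eq_bigr => i _.
  have -> : widen_ord (leqnSn n) i = lift ord_max i.
    by apply/ord_inj; rewrite lift_max.
  by rewrite liftK.
rewrite ge0_integralZl_EFin //.
- by rewrite gI -EFinM exprSr mulrA.
- by move=> x _; rewrite lee_fin.
- exact/measurable_EFinP.
- by rewrite mulr_ge0 ?exprn_ge0.
Qed.

Lemma iint_ge0 (T : finType) (f : (T -> R) -> \bar R) :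
  (forall y, 0 <= f y)%E -> (0 <= iint f)%E.
Proof. by move=> f0; apply: iint_n_ge0 => y; exact: f0. Qed.

Lemma iint_le (T : finType) (f g : (T -> R) -> \bar R) :
  (forall y, 0 <= f y)%E -> (forall y, f y <= g y)%E -> (iint f <= iint g)%E.
Proof. by move=> f0 fg; apply: iint_n_le => y; [exact: f0|exact: fg]. Qed.

Lemma iint_prod (T : finType) (g : R -> R) (I c : R) :
  measurable_fun setT g -> (forall x, 0 <= g x) -> 0 <= c ->
  (\int[@lebesgue_measure R]_x (g x)%:E = I%:E)%E ->
  (iint (fun y : T -> R => (c * \prod_t g (y t))%:E) = (c * I ^+ #|T|)%:E)%E.
Proof.
move=> mg g0 c0 gI; rewrite -(iint_n_prod _ mg g0 c0 gI).
congr iint_n; apply/funext => y; congr (_ * _)%:E.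
rewrite (reindex _ (onW_bij _ (@enum_val_bij T))) /=.
by apply: eq_bigr => i _; rewrite enum_valK.
Qed.

(** The integrand is a multiple of the centred normal density of variance 1 / (2 s). *)
Lemma integral_gauss_scaled (s : R) : 0 < s ->
  exists I : R,
    (\int[@lebesgue_measure R]_x (expR (- (s * x ^+ 2)))%:E = I%:E)%E.
Proof.
move=> s0; pose sg : R := Num.sqrt (s *+ 2)^-1.
have s20 : 0 < (s *+ 2)^-1 by rewrite invr_gt0 pmulrn_rgt0.
have sg0 : sg != 0 by rewrite gt_eqF // sqrtr_gt0.
have pdfE x : normal_pdf 0 sg x = normal_peak sg * normal_fun 0 sg x.
  by rewrite normal_pdfE.
have sE (y : R) : - (s * y) = - y / ((s *+ 2)^-1 *+ 2).
  by have s1 : s != 0; [rewrite gt_eqF | field].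
exists (normal_peak sg)^-1.
transitivity (\int[@lebesgue_measure R]_x
    (((normal_peak sg)^-1)%:E * (normal_pdf 0 sg x)%:E))%E.
  apply: eq_integral => x _; rewrite -EFinM pdfE [in RHS]mulrA mulVf; last first.
    by rewrite gt_eqF // normal_peak_gt0.
  rewrite mul1r /normal_fun subr0 sqr_sqrtr ?ltW //; congr (expR _)%:E.
  exact: sE.
rewrite ge0_integralZl_EFin //.
- by rewrite integral_normal_pdf mule1.
- by move=> x _; rewrite lee_fin normal_pdf_ge0.
- by apply/measurable_EFinP; exact: measurable_normal_pdf.
- by rewrite invr_ge0 normal_peak_ge0.
Qed.

Lemma measurable_gauss_scaled (s : R) :
  measurable_fun setT (fun x : R => expR (- (s * x ^+ 2))).
Proof.
apply: measurableT_comp => //; apply: measurableT_comp => //.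
apply: measurable_funM => //; exact: measurable_funX.
Qed.

(** * Finiteness of the field integral and of its average over h *)

Lemma int_Da_abs_ge0 N (K : 'M[R[i]]_N) : (0 <= int_Da_abs K)%E.
Proof.
apply: iint_ge0 => u; rewrite lee_fin norm_cexp /= mulr_ge0 ?expR_ge0 //.
by rewrite invr_ge0 exprn_ge0 // pi_ge0.
Qed.

(** Coercivity dominates the integrand by a product of Gaussians in the real and imaginary parts.
    The bound [M] is fixed before [K], hence uniform over real fields once [s] is. *)
Lemma int_Da_abs_bounded N (s : R) : 0 < s -> exists2 M : R, 0 <= M &
  forall K : 'M[R[i]]_N,
    (forall a : 'rV[R[i]]_N, s%:C * \sum_p `|a 0 p| ^+ 2 <=
                 (complex.Re (quadform K a))%:C) ->
    (int_Da_abs K <= M%:E)%E.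
Proof.
move=> s0; have [I gI] := integral_gauss_scaled s0.
set c : R := (pi ^+ N)^-1.
have c0 : 0 <= c by rewrite invr_ge0 exprn_ge0 // pi_ge0.
exists (c * I ^+ #|{: 'I_N * bool}|).
  rewrite mulr_ge0 ?exprn_ge0 // -lee_fin -gI.
  by apply: integral_ge0 => x _; rewrite lee_fin expR_ge0.
move=> K Ks.
rewrite -(iint_prod _ (measurable_gauss_scaled s) _ c0 gI); last first.
  by move=> x; exact: expR_ge0.
apply: iint_le => u; first by rewrite lee_fin norm_cexp mulr_ge0 ?expR_ge0.
rewrite lee_fin norm_cexp ler_wpM2l //= -expR_sum ler_expR.
have -> : complex.Re (- quadform K (acoord u)) =
    - complex.Re (quadform K (acoord u)).
  by case: (quadform _ _).
rewrite sumrN lerN2 -lecR; apply: le_trans (Ks _).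
rewrite -mulr_sumr rmorphM ler_wpM2l //; first by rewrite ler0c ltW.
have -> : \sum_t u t ^+ 2 = \sum_p \sum_b u (p, b) ^+ 2.
  by rewrite pair_bigA; apply: eq_bigr => -[].
rewrite rmorph_sum.
apply: ler_sum => p _; rewrite mxE -add_Re2_Im2 /= big_bool /= lecR.
by rewrite addrC.
Qed.

(** Bounding [F] by [M] leaves [M] times the product density [gdens], whose total integral is
    finite. *)
Lemma int_muV_finite nt n (v : 'M[R]_n) (F : 'M[R]_(nt, n) -> \bar R) (M : R) :
  0 <= M -> (forall h, 0 <= F h)%E -> (forall h, F h <= M%:E)%E ->
  (int_muV v F < +oo)%E.
Proof.
move=> M0 F0 FM; have h0 : 0 < 2^-1 :> R by rewrite invr_gt0.
pose g (x : R) := expR (- (x ^+ 2) / 2) / Num.sqrt (pi *+ 2).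
have [I gI] := integral_gauss_scaled h0.
have g0 x : 0 <= g x by rewrite divr_ge0 ?expR_ge0 ?sqrtr_ge0.
have gE : g = fun x => (Num.sqrt (pi *+ 2))^-1 * expR (- (2^-1 * x ^+ 2)).
  by apply/funext => x; rewrite /g mulrC; congr (_ * expR _); rewrite mulNr mulrC.
have mg : measurable_fun setT g.
  by rewrite gE; apply: measurable_funM => //; exact: measurable_gauss_scaled.
have gI' : (\int[@lebesgue_measure R]_x (g x)%:E =
    ((Num.sqrt (pi *+ 2))^-1 * I)%:E)%E.
  rewrite EFinM -gI -ge0_integralZl_EFin //.
  - by apply: eq_integral => x _; rewrite gE.
  - by apply/measurable_EFinP; exact: measurable_gauss_scaled.
apply: le_lt_trans (ltry (M * ((Num.sqrt (pi *+ 2))^-1 * I) ^+ #|{: 'I_nt * 'I_n}|)).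
rewrite -(iint_prod _ mg g0 M0 gI').
have gd0 (z : 'I_nt * 'I_n -> R) : 0 <= gdens z.
  by apply: prodr_ge0 => t _; exact: g0.
apply: iint_le => z; first by rewrite mule_ge0 ?lee_fin.
rewrite (_ : (M * _)%:E = (gdens z)%:E * M%:E)%E; last by rewrite mulrC EFinM.
by apply: lee_pmul; rewrite ?lee_fin.
Qed.

End IteratedIntegral.

(** * The propagator *)

Section Propagator.
Variables (R : realType) (d L nt : nat) (beta mu : R).
Variables (E : 'M[R[i]]_#|Lam d L|).
Local Notation n := #|Lam d L|.
Local Notation C := R[i].
Local Notation ep := (eps nt beta).
Local Notation K := (@Kmx R d L nt beta mu E).
Local Notation S := (@Smx R d L nt beta mu E).

Lemma hermitian_Emu : hermitian E -> hermitian (Emu mu E).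
Proof.
rewrite /hermitian /Emu => hE; rewrite linearB /= tr_scalar_mx hE map_mxB.
by rewrite map_scalar_mx /= oppr0.
Qed.

Lemma norm_phase (h : 'M[C]_(nt, n)) k x :
  `|phase beta h k x| = (expR (- (Num.sqrt ep * complex.Im (h k x))))%:C.
Proof.
rewrite norm_cexp; congr (expR _)%:C; case: (h k x) => a b /=.
by ring.
Qed.

Lemma norm_phase_realC (h : 'M[R]_(nt, n)) k x :
  `|phase beta (realC h) k x| = 1.
Proof. by rewrite norm_phase mxE /= mulr0 oppr0 expR0. Qed.

Lemma phase0 k x : phase beta (0 : 'M[C]_(nt, n)) k x = 1.
Proof. by rewrite /phase mxE mulr0 cexp0. Qed.

(** For real [h] the phases have modulus 1, and the stochastic hypothesis at time [ep] makes the
    entries of the exponential nonnegative, hence equal to their moduli. *)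
Lemma Smx_dominated (h : 'M[R]_(nt, n)) p q : 0 < ep ->
  generates_stochastic (Emu mu E) -> `|S (realC h) p q| <= S 0 p q.
Proof.
move=> e0 st; rewrite !mxE; apply: le_trans (ler_normD _ _) _.
rewrite normr_nat lerD2r; apply: le_trans (ler_norm_sum _ _ _) _.
apply: ler_sum => k _; rewrite normrM norm_phase_realC phase0 !mulr1 ger0_norm //.
exact/st/ltW.
Qed.

Lemma differentiable_Kmx (h : 'M[C]_(nt, n)) p q :
  cdifferentiable (fun h' => K h' p q) h.
Proof.
rewrite /cdifferentiable.
have dc (c : C) : cdifferentiable (fun _ : 'M[C]_(nt, n) => c) h.
  exact: differentiable_cst.
rewrite (_ : (fun h' => _) = fun h' => (p == q)%:R - S h' p q); last first.
  by apply/funext => h'; rewrite Kmx_Smx !mxE.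
apply: (@differentiableB C _ _ (fun _ => (p == q)%:R : C^o)); first exact: dc.
rewrite (_ : (fun h' => _) =
  fun h' => Sentry beta mu E h' (enum_val p) (enum_val q)); last first.
  by apply/funext => h'; rewrite mxE.
apply: (@differentiableD C _ C^o (fun h' => \sum_(k < nt | _) _)); last exact: dc.
under eq_fun do rewrite big_mkcond.
apply: (@differentiable_bigsum C) => k.
case: (((enum_val p).1 == k :> nat) && _); last exact: dc.
apply: (@differentiableM C _ (cst _)); first exact: dc.
apply: (@differentiable_comp C _ C^o C^o
  (fun h' : 'M[C]_(nt, n) => 'i * (Num.sqrt ep)%:C * h' k (enum_val q).2)
  (fun w => cexp w)).
  apply: (@differentiableM C _ (cst _)); first exact: dc.
  exact: differentiable_coord.
exact: differentiable_cexp.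
Qed.

End Propagator.

(** The norm on matrices is the largest modulus of an entry, so entrywise bounds on the inverse
    suffice. *)
Lemma mx_norm_le (R : rcfType) m p (A : 'M[R[i]]_(m, p)) (M : R) :
  0 <= M -> (forall i j, `|A i j| <= M%:C) -> `|A| <= M%:C.
Proof.
move=> M0 AM; have [->|A0] := eqVneq `|A| 0; first by rewrite ler0c.
by have [[i j] Aij] := mx_norm_neq0 A0; rewrite [leLHS]Aij; exact: AM.
Qed.

(** * Assembly of the bounds on real fields, on the strip and between inverses *)

Unset Implicit Arguments.
Theorem theorem8p1 (R : realType) (d L nt : nat) (beta mu : R)
  (E : 'M[R[i]]_#|Lam d L|) (v : 'M[R]_#|Lam d L|) :
  (0 < L)%N -> (0 < nt)%N -> 0 < beta ->
  hermitian E -> symmetric_psd v ->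
  posdef (Emu mu E) ->
  let eps := eps nt beta in
  let K := @Kmx R d L nt beta mu E in
  let G := @Gmx R d L nt beta mu E in
  (* absolute convergence of the integral *)
  (int_muV v (fun h => int_Da_abs (K (realC h))) < +oo)%E
  (* G(h) = K(h)^{-1} exists for all real h, with norm bounded uniformly *)
  /\ (forall h : 'M[R]_(nt, #|Lam d L|), K (realC h) \in unitmx)
  /\ (exists M : R, forall h : 'M[R]_(nt, #|Lam d L|), `| G (realC h) | <= M%:C)
  (* analyticity in the strip |Im h_{j,x}| < sqrt(eps) e_min *)
  /\ (forall emin : R,
        eigenvalue (Emu mu E) emin%:C ->
        (forall l, eigenvalue (Emu mu E) l -> emin%:C <= l) ->
        forall h : 'M[R[i]]_(nt, #|Lam d L|),
          (forall k x, `| complex.Im (h k x) | < Num.sqrt eps * emin) ->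
          K h \in unitmx /\
          forall p q, cdifferentiable (fun h' => G h' p q) h)
  (* domination by G(0) when E_mu generates a stochastic process *)
  /\ (generates_stochastic (Emu mu E) ->
        forall (h : 'M[R]_(nt, #|Lam d L|)) (j j' : 'I_nt.+1) (x x' : 'I_#|Lam d L|),
          (j <= j')%N ->
          `| G (realC h) (idx j x) (idx j' x') | <= G 0 (idx j x) (idx j' x')).
Proof.
move=> L0 nt0 beta0 hE _ pE ep K G.
have ep0 : 0 < ep by rewrite divr_gt0 // ltr0n.
have [l [lE Xle]] := form_le_expm (hermitian_Emu mu hE).
have l0 i : 0 < l i by exact: posdef_eigenvalue_gt0 pE (lE i).
have [e0 e00 el] : exists2 e0 : R, 0 < e0 & forall i, e0 <= l i.
  (* The default value 1 is itself positive; any positive lower bound of the spectrum serves for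
     real fields. *)
  exists (\big[Num.min/1]_i l i); last by move=> i; exact: bigmin_le.
  by elim/big_ind: _ => // x y x0 y0; rewrite lt_min x0.
pose c0 := expR (- (ep * e0)).
have c01 : c0 < 1 by rewrite expR_lt1 oppr_lt0 mulr_gt0.
(* The bound of [numrad_Smx] with M = 1, as the phases of real fields are unimodular; it does not
   depend on the field. *)
pose c := (1 + c0 * 1) / 2.
have c1 : c < 1 by rewrite /c; lra.
have Sc (h : 'M[R]_(nt, #|Lam d L|)) : numrad_le (Smx beta mu E (realC h)) c.
  apply: (@numrad_Smx _ _ _ _ _ _ _ _ c0 1) => //.
  - by apply: Xle => //; exact: ltW.
  - exact: expR_ge0.
  - by rewrite mulr1 ltW.
  - by move=> k x; rewrite norm_phase_realC.
have cpos : 0 < 1 - c by rewrite subr_gt0.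
split; [|split; [|split; [|split]]].
- have [M M0 hM] := int_Da_abs_bounded #|{: XT d L nt}| cpos.
  apply: (@int_muV_finite R nt _ v (fun h => int_Da_abs (K (realC h))) M M0) => h.
    exact: int_Da_abs_ge0.
  by apply: hM => a; rewrite /K Kmx_Smx; exact: numrad_coercive_Re (Sc h) a.
- by move=> h; rewrite /K Kmx_Smx; exact: numrad_unit (Sc h) c1.
- exists (1 - c)^-1 => h; apply: mx_norm_le => [|p q].
    by rewrite invr_ge0 ltW.
  by rewrite /G /Gmx Kmx_Smx; exact: numrad_inv_bound (Sc h) c1 p q.
- move=> emin emE eminl h him.
  have emin0 := posdef_eigenvalue_gt0 pE emE.
  (* The phases are bounded by e^eta; a maximum over finitely many sites turns the pointwise strict
     inequalities of the strip into eta < eps emin. *)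
  pose eta := \big[Num.max/0]_(kx : 'I_nt * 'I_#|Lam d L|)
    (Num.sqrt ep * `|complex.Im (h kx.1 kx.2)|).
  have eta1 : eta < ep * emin.
    apply/bigmax_ltP; split; first by rewrite mulr_gt0.
    move=> kx _; rewrite -[X in _ < X * _]sqr_sqrtr ?ltW // expr2 -mulrA.
    by rewrite ltr_pM2l ?sqrtr_gt0.
  have eminle i : emin <= l i by rewrite -lecR; exact: (eminl _ (lE i)).
  have cM : expR (- (ep * emin)) * expR eta < 1.
    by rewrite -expRD expR_lt1 addrC subr_lt0.
  have uK : K h \in unitmx.
    rewrite /K Kmx_Smx; apply: (@numrad_unit _ _ _
      ((1 + expR (- (ep * emin)) * expR eta) / 2)); last by lra.
    apply: (@numrad_Smx _ _ _ _ _ _ _ _ (expR (- (ep * emin))) (expR eta)) => //.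
    + exact: (Xle emin ep (ltW ep0) eminle).
    + exact: expR_gt0.
    + exact: ltW.
    + move=> k x; rewrite norm_phase lecR ler_expR.
      apply: le_trans (le_bigmax _ _ (k, x)) => /=.
      by rewrite -mulrN ler_wpM2l ?sqrtr_ge0 // -normrN ler_norm.
  split=> // p q.
  by apply: (@differentiable_invmx R[i]) => // i j; exact: differentiable_Kmx.
- move=> st h j j' x x' _.
  (* The zero field is real, so the bound for real fields covers S(0) with the same [c]. *)
  have r0 : realC 0 = 0 :> 'M[R[i]]_(nt, #|Lam d L|).
    by apply/matrixP => k y; rewrite !mxE.
  rewrite /G /Gmx !Kmx_Smx; apply: (invmx_dominated (Sc h) c1 _ c1).
    by rewrite -r0; exact: Sc.
  by move=> p q; exact: Smx_dominated.
Qed.
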